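(* Let $k\in\{1,2,3,4\}$ and let $n$ be an integer with $n\ge 2k$. Let $\lambda,\mu$ be partitions of $n$ both having first part $n-k$. If $\mu<\lambda$ in lexicographic order, then $|\eta_\mu|\le|\eta_\lambda|$. Moreover, if $n\ge 7$ then $\mu<\lambda$ implies $|\eta_\mu|<|\eta_\lambda|$; thus for $n\ge7$, the absolute values $|\eta_\lambda|$ over partitions with first part $n-k$ strictly decrease in lexicographic order.
   Context: For $n\ge 1$, $\mathcal{D}_n$ is the set of derangements in $S_n$. For $\lambda\vdash n$, $\chi_\lambda$ is the irreducible character of $S_n$ indexed by $\lambda$ and $\eta_\lambda=\frac{1}{\chi_\lambda(1)}\sum_{\sigma\in\mathcal{D}_n}\chi_\lambda(\sigma)$. For partitions $\lambda=(\lambda_1,\ldots)$ and $\mu=(\mu_1,\ldots)$ of $n$, $\lambda>\mu$ in lexicographic order if for some $i$, $\lambda_j=\mu_j$ for $j<i$ and $\lambda_i>\mu_i$. *)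

(* Defs.v *)
From mathcomp Require Import all_boot all_order all_algebra.
From mathcomp Require Import all_fingroup all_solvable all_field all_character.

Set Implicit Arguments.
Unset Strict Implicit.
Unset Printing Implicit Defensive.

Import Order.TTheory GRing.Theory Num.Theory.

Local Open Scope ring_scope.

Definition is_partition (n : nat) (la : seq nat) : bool :=
  [&& sorted geq la, 0%N \notin la & sumn la == n].

(* Partitions of different lengths are compared as if padded with zeros. *)
Definition lex_lt (mu la : seq nat) : Prop :=
  exists i : nat,
    (forall j : nat, (j < i)%N -> nth 0%N mu j = nth 0%N la j) /\
    (nth 0%N mu i < nth 0%N la i)%N.

(* The Young diagram of la is filled with 0, ..., n.-1 row by row, from left
   to right; the entry i then lies in row reshape_index la i and column
   reshape_offset la i. *)
Definition row_stab (n : nat) (la : seq nat) : {set 'S_n} :=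
  [set s : 'S_n |
    [forall i : 'I_n, reshape_index la (s i) == reshape_index la i]].

Definition col_stab (n : nat) (la : seq nat) : {set 'S_n} :=
  [set s : 'S_n |
    [forall i : 'I_n, reshape_offset la (s i) == reshape_offset la i]].

Definition Sn_regular (n : nat) :
    mx_representation algC [set: 'S_n]%G #|[set: 'S_n]%G| :=
  regular_repr algC [set: 'S_n]%G.

(* The element \sum_(p, q) sgn(q) p q of the group algebra, as a vector of
   coordinates in the basis 'S_n. *)
Definition young_symmetrizer (n : nat) (la : seq nat) :
    'rV[algC]_#|[set: 'S_n]%G| :=
  gring_row (\sum_(p in row_stab n la) \sum_(q in col_stab n la)
               (-1) ^+ (q : bool) *: Sn_regular n (p * q)%g).

(* The Specht module of la: MathComp's regular representation acts by right
   multiplication, so this is the right ideal of the group algebra generated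
   by the Young symmetrizer. *)
Definition specht_repr (n : nat) (la : seq nat) :=
  submod_repr (cyclic_mx_module (Sn_regular n) (young_symmetrizer n la)).

Definition chi (n : nat) (la : seq nat) : 'CF([set: 'S_n]%G) :=
  cfRepr (specht_repr n la).

Definition derangements (n : nat) : {set 'S_n} :=
  [set s : 'S_n | [forall i : 'I_n, s i != i]].

Definition eta (n : nat) (la : seq nat) : algC :=
  (chi n la 1%g)^-1 * \sum_(s in derangements n) chi n la s.

(* Main.v *)
(* Let a be the sum of the row stabilizer and b the signed sum of the column
   stabilizer of a diagram. Von Neumann's lemma says that a s b is a multiple of
   the Young symmetrizer a b, namely by sgn q if s = p q with p in the row and q
   in the column stabilizer, and by 0 otherwise. The sum of the derangements is
   central, so it acts on the Specht module as the scalar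
   sum over (p, q), p q a derangement, of sgn q, and this scalar is eta.
   The product p q fixes a cell only if p and q both do, so inclusion-exclusion
   over the fixed cells turns eta into the sum of
   (-1)^(n - |A|) prod_y |A cap row y|! over the sets A of cells with at most one
   cell in each column. When the diagram is a row of length m followed by the
   diagram nu of size k, summing over the part of A in the first row gives
   |eta| = sum_j w_j(nu) d_(m - j), where d_i is the number of derangements of i
   points and w_j(nu) the sum of prod_y |C cap row y|! over the transversal sets
   C of j cells of nu. For k <= 4 every w_j decreases weakly, and w_2 strictly,
   along the lexicographic order. *)
Require Import Defs.
From mathcomp Require Import all_boot all_order all_algebra.
From mathcomp Require Import all_fingroup all_solvable all_field all_character.
From mathcomp Require Import zify.

Set Implicit Arguments.
Unset Strict Implicit.
Unset Printing Implicit Defensive.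

Import Order.TTheory GRing.Theory Num.Theory.

Local Open Scope ring_scope.

(** * Permutations preserving the fibres of a function *)

Section FiberStabilizer.

Variables (T : finType) (f : T -> nat).

Definition fiber_stab : {set {perm T}} :=
  [set s : {perm T} | [forall i, f (s i) == f i]].

Lemma fiber_stabP (s : {perm T}) :
  reflect (forall i, f (s i) = f i) (s \in fiber_stab).
Proof. by rewrite inE; apply: (iffP forallP) => H i; apply/eqP; exact: H. Qed.

Lemma fiber_stab_group_set : group_set fiber_stab.
Proof.
apply/group_setP; split=> [|s t /fiber_stabP fs /fiber_stabP ft].
  by apply/fiber_stabP=> i; rewrite perm1.
by apply/fiber_stabP=> i; rewrite permM ft fs.
Qed.
Canonical fiber_stab_group := Group fiber_stab_group_set.

Lemma tperm_fiber_stab i j : f i = f j -> tperm i j \in fiber_stab.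
Proof. by move=> fij; apply/fiber_stabP=> x; case: tpermP => // ->. Qed.

Lemma perm_on_tperm (A : {set T}) i j :
  i \in A -> j \in A -> perm_on A (tperm i j).
Proof.
move=> Ai Aj; apply/subsetP=> x; rewrite inE /=.
by case: tpermP => [-> | -> |] //; rewrite eqxx.
Qed.

Definition fiber_stab_on (A : {set T}) : {set {perm T}} :=
  [set s in fiber_stab | perm_on A s].

Lemma in_fiber_stab_on A s :
  (s \in fiber_stab_on A) = (s \in fiber_stab) && perm_on A s.
Proof. exact: in_set. Qed.

Lemma fiber_stab_on_group_set A : group_set (fiber_stab_on A).
Proof.
apply/group_setP; split=> [|s t]; first by rewrite in_fiber_stab_on perm_on1 group1.
rewrite !in_fiber_stab_on => /andP[fs As] /andP[ft At].
by rewrite groupM ?perm_onM.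
Qed.
Canonical fiber_stab_on_group A := Group (fiber_stab_on_group_set A).

(** Orbit-stabilizer: the orbit of a point i of A is its fibre within A, and its stabilizer is the
    same kind of group on A minus i. *)
Lemma card_fiber_stab_on (N : nat) (A : {set T}) :
    (forall i, (f i < N)%N) ->
  #|fiber_stab_on A|
    = (\prod_(r < N) #|[set i in A | f i == r]|`!)%N.
Proof.
move=> ltfN; move: {2}#|A| (leqnn #|A|) => m.
elim: m A => [|m IHm] A leAm.
  have A0 : A = set0 by apply/eqP; rewrite -cards_eq0 -leqn0.
  rewrite big1 => [|r _]; last first.
    by rewrite (_ : [set _ in _ | _] = set0) ?cards0 // A0;
      apply/setP=> i; rewrite !inE.
  rewrite (_ : fiber_stab_on A = [set 1%g]) ?cards1 //.
  apply/setP=> s; rewrite in_fiber_stab_on in_set1; apply/andP/eqP=> [[_ As]|->].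
    by apply: perm_on_id As _; rewrite A0 cards0.
  by rewrite group1 perm_on1.
have [A0 | [i Ai]] := set_0Vmem A.
  by apply: IHm; rewrite A0 cards0.
have leA'm : (#|A :\ i| <= m)%N by move: leAm; rewrite (cardsD1 i A) Ai.
rewrite -(card_orbit_stab 'P (fiber_stab_on_group A) i) /=.
have -> : orbit 'P (fiber_stab_on A) i
        = [set j in A | f j == f i].
  apply/setP=> j; apply/orbitP/idP=> [[s] | ].
    rewrite in_fiber_stab_on => /andP[/fiber_stabP fs As] /= <-.
    by rewrite inE apermE perm_closed // Ai fs /=.
  rewrite inE => /andP[Aj /eqP fj]; exists (tperm i j); last first.
    by rewrite /= apermE tpermL.
  by rewrite in_fiber_stab_on tperm_fiber_stab ?perm_on_tperm.
have -> : 'C_(fiber_stab_on A)[i | 'P]%g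
        = fiber_stab_on (A :\ i).
  apply/setP=> s; rewrite in_setI !in_fiber_stab_on -andbA.
  congr (_ && _); apply/andP/idP=> [[As /astab1P /= si] | As].
    apply/subsetP=> x; rewrite !inE => sx; rewrite (subsetP As) // andbT.
    by apply: contraNneq sx => ->; rewrite -[s i]/(aperm i s) si.
  split; last by apply/astab1P; rewrite /= apermE (out_perm As) // !inE eqxx.
  by apply: subset_trans As _; exact: subD1set.
rewrite {}IHm // (bigD1 (Ordinal (ltfN i))) //= [RHS](bigD1 (Ordinal (ltfN i))) //=.
rewrite (cardsD1 i [set j in A | f j == f i]) inE Ai eqxx /= add1n factS mulnA.
have -> : [set j in A | f j == f i] :\ i = [set j in A :\ i | f j == f i].
  by apply/setP=> j; rewrite !inE andbA.
congr (_ * _)%N; apply: eq_bigr => r neq_r; congr (_`!); apply: eq_card => j.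
rewrite !inE; have [-> | //] := eqVneq j i.
rewrite Ai /=; apply/esym/negbTE; apply: contraNneq neq_r => fi.
exact/eqP/val_inj.
Qed.

End FiberStabilizer.

(** * Row and column stabilizers, von Neumann's lemma *)

Section RowColumn.

Variables (T : finType) (r c : T -> nat).
Hypothesis rc_inj : forall i j, r i = r j -> c i = c j -> i = j.
(* Rows are left-justified. *)
Hypothesis rc_left : forall i j,
  (c j <= c i)%N -> exists2 i', r i' = r i & c i' = c j.

Local Notation P := (fiber_stab r).
Local Notation Q := (fiber_stab c).

(** If [t (s i) = i], then [s i] shares its row with i through s and its column through t, so
    [s i = i]. *)
Lemma row_col_fixed (s t : {perm T}) i :
  s \in P -> t \in Q -> (t (s i) == i) = (s i == i) && (t i == i).
Proof.
move=> /fiber_stabP rs /fiber_stabP ct; apply/eqP/andP=> [ts | [/eqP-> /eqP//]].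
have si : s i = i by apply: rc_inj; rewrite ?rs // -[in RHS]ts ct.
by move: ts; rewrite si => ->; rewrite eqxx.
Qed.

Lemma row_col_TI s : s \in P -> s \in Q -> s = 1%g.
Proof.
move=> /fiber_stabP rs /fiber_stabP cs; apply/permP=> i.
by rewrite perm1; apply: rc_inj.
Qed.

Lemma row_col_decomp_uniq p q p' q' :
    p \in P -> q \in Q -> p' \in P -> q' \in Q ->
  (p * q = p' * q')%g -> p = p' /\ q = q'.
Proof.
move=> Pp Qq Pp' Qq' eq_pq.
have e1 : (p'^-1 * p = 1)%g.
  apply: row_col_TI; first by rewrite groupM ?groupV.
  by rewrite (_ : p'^-1 * p = q' * q^-1)%g ?groupM ?groupV //;
     apply: (mulgI p'); apply: (mulIg q); rewrite mulKVg eq_pq mulgA mulgKV.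
have pp' : p = p' by apply: (mulgI p'^-1%g); rewrite e1 mulVg.
by split=> //; move: eq_pq; rewrite pp' => /mulgI.
Qed.

(* If s puts no two entries of a row into one column, then for every J each
   row sends at most as many entries into the first J columns as it has there.
   The totals agree, so equality holds in each row, and with J the length of
   the row, the row is mapped into columns that it meets. *)
Lemma row_meets_column (s : {perm T}) :
    (forall i j, r i = r j -> c (s i) = c (s j) -> i = j) ->
  forall i, exists j, (r j == r i) && (c j == c (s i)).
Proof.
move=> s_inj i0.
pose N := (\max_i r i).+1.
have ltrN i : (r i < N)%N by rewrite ltnS; exact: (leq_bigmax i).
have [im /eqP rim maxim] := @arg_maxnP _ i0 (fun i => r i == r i0) c (eqxx _).
pose J := c im.
pose X y := [set i | (r i == y) && (c (s i) <= J)%N].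
pose Y y := [set i | (r i == y) && (c i <= J)%N].
(* Either row y reaches column J and, being left-justified, meets all columns up to J, among them
   the distinct columns of the images of [X y]; or it ends before J, and [Y y] is the whole row. *)
have leXY y : (#|X y| <= #|Y y|)%N.
  have [/existsP[i1 /andP[/eqP ri1 ltJ]] | ] :=
      boolP [exists i, (r i == y) && (J <= c i)%N].
    rewrite !cardE -(size_map (c \o s)) -(size_map c (enum (Y y))).
    apply: uniq_leq_size.
      rewrite map_inj_in_uniq ?enum_uniq // => i j; rewrite !mem_enum !inE /=.
      by move=> /andP[/eqP ri _] /andP[/eqP rj _]; apply: s_inj; rewrite ri rj.
    move=> z /mapP[i]; rewrite mem_enum inE => /andP[/eqP ri leJ] ->.
    have [i' ri' ci'] := rc_left (leq_trans leJ ltJ).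
    apply/mapP; exists i'; last by rewrite ci'.
    by rewrite mem_enum inE ri' ri1 eqxx ci'.
  rewrite negb_exists => /forallP noJ; apply/subset_leq_card/subsetP=> i.
  rewrite !inE => /andP[ri _]; rewrite ri /=.
  by have := noJ i; rewrite ri /= -ltnNge => /ltnW.
have sumr (B : pred T) : 
    (\sum_(y < N) #|[set i | (r i == y) && B i]|)%N = #|[set i | B i]|.
  rewrite -[RHS]sum1_card (partition_big (fun i => Ordinal (ltrN i)) xpredT) //=.
  apply: eq_bigr => y _; rewrite -sum1_card; apply: eq_bigl => i.
  by rewrite !inE andbC -val_eqE.
have eqXY : forall y : 'I_N, #|X y| = #|Y y|.
  have /leqif_sum/= leif (y : 'I_N) :
    true -> (#|X y| <= #|Y y| ?= iff (#|X y| == #|Y y|))%N by [].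
  have /forallP eqXY : [forall (y : 'I_N | true), #|X y| == #|Y y|].
    rewrite -(geq_leqif leif) !sumr.
    rewrite -(card_preimset [set i | (c i <= J)%N] (@perm_inj _ s)).
    by rewrite eq_leq //; apply: eq_card => i; rewrite !inE.
  by move=> y; apply/eqP; have := eqXY y.
have Xi0 : i0 \in X (r i0).
  have : X (r i0) == [set i | r i == r i0].
    rewrite eqEcard; apply/andP; split.
      by apply/subsetP=> i; rewrite !inE => /andP[].
    rewrite (eqXY (Ordinal (ltrN i0))) subset_leq_card //=.
    by apply/subsetP=> i; rewrite !inE => ri; rewrite ri; exact: maxim.
  by move=> /eqP->; rewrite inE.
move: Xi0; rewrite inE eqxx /= => leJ.
have [i' ri' ci'] := rc_left leJ.
by exists i'; rewrite ri' rim ci' !eqxx.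
Qed.

(** Let p move each i within its row to the column of [s i]. It is injective because s separates row
    mates by column, and the remaining factor [p^-1 * s] preserves columns. *)
Lemma row_col_factor (s : {perm T}) :
    (forall i j, r i = r j -> c (s i) = c (s j) -> i = j) ->
  exists2 p, p \in P & exists2 q, q \in Q & s = (p * q)%g.
Proof.
move=> s_inj.
have [g gP] := fin_all_exists (row_meets_column s_inj).
have rg i : r (g i) = r i by have /andP[/eqP] := gP i.
have cg i : c (g i) = c (s i) by have /andP[_ /eqP] := gP i.
have g_inj : injective g.
  move=> i j eq_g; apply: s_inj; first by rewrite -(rg i) -(rg j) eq_g.
  by rewrite -(cg i) -(cg j) eq_g.
exists (perm g_inj); first by apply/fiber_stabP=> i; rewrite permE.
exists ((perm g_inj)^-1 * s)%g; last by rewrite mulKVg.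
by apply/fiber_stabP=> i; rewrite permM -cg -(permE g_inj) permKV.
Qed.

Variables (F : fieldType) (d : nat)
  (rG : mx_representation F [set: {perm T}]%G d).
Hypothesis F2 : 2 != 0 :> F.

Definition row_sum := \sum_(p in P) rG p.
Definition col_sum := \sum_(q in Q) (-1) ^+ (q : bool) *: rG q.

(** At most one factorization s = p q exists, so this is sgn q if there is one and 0 otherwise. *)
Definition row_col_coef (s : {perm T}) : F :=
  \sum_(p in P) \sum_(q in Q | (p * q == s)%g) (-1) ^+ (q : bool).

Let rGM (s t : {perm T}) : rG (s * t)%g = rG s *m rG t.
Proof. by rewrite repr_mxM ?inE. Qed.

Lemma row_sum_mull p : p \in P -> row_sum *m rG p = row_sum.
Proof.
move=> Pp; rewrite /row_sum mulmx_suml [RHS](reindex_inj (mulIg p)) /=.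
by apply: eq_big => [t | t _]; rewrite ?groupMr // rGM.
Qed.

Lemma col_sum_mulr q :
  q \in Q -> rG q *m col_sum = (-1) ^+ (q : bool) *: col_sum.
Proof.
move=> Qq; rewrite /col_sum mulmx_sumr [in RHS](reindex_inj (mulgI q)) /=.
rewrite scaler_sumr; apply: eq_big => [t | t _]; rewrite ?groupMl //.
by rewrite -scalemxAr scalerA odd_permM signr_addb mulrA -expr2 sqrr_sign mul1r rGM.
Qed.

(** Von Neumann's lemma. If s sends two entries of a row into one column, absorbing their
    transposition on the left and its conjugate on the right shows the product to be its own
    negative. Otherwise s = p q, and both factors are absorbed. *)
Lemma row_sum_mul_col_sum s :
  row_sum *m rG s *m col_sum = row_col_coef s *: (row_sum *m col_sum).
Proof.
have [/existsP[i /existsP[j /and3P[neq_ij /eqP rij /eqP cij]]] | no_ij] :=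
    boolP [exists i, exists j, [&& i != j, r i == r j & c (s i) == c (s j)]].
  have -> : row_col_coef s = 0.
    apply: big1 => p Pp; apply: big1 => q /andP[Qq /eqP def_s].
    case/eqP: neq_ij; apply: (@perm_inj _ p); move: cij.
    rewrite -def_s !permM !(fiber_stabP _ _ Qq).
    by apply: rc_inj; rewrite !(fiber_stabP _ _ Pp).
  rewrite scale0r.
  have e1 : row_sum *m rG s *m col_sum = - (row_sum *m rG s *m col_sum).
    rewrite -{1}(row_sum_mull (tperm_fiber_stab rij)) -(mulmxA row_sum) -rGM.
    have -> : (tperm i j * s = s * tperm (s i) (s j))%g.
      by rewrite -tpermJ -conjgC.
    rewrite rGM -!mulmxA col_sum_mulr ?tperm_fiber_stab //.
    by rewrite odd_tperm (inj_eq perm_inj) neq_ij scaleN1r !mulmxN.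
  apply/eqP; have /eqP := e1; rewrite -subr_eq0 opprK -mulr2n -scaler_nat.
  by rewrite scaler_eq0 (negbTE F2).
have [|p Pp [q Qq def_s]] := @row_col_factor s.
  move=> i j rij cij; apply/eqP/negPn/negP=> neq_ij; case/negP: no_ij.
  by apply/existsP; exists i; apply/existsP; exists j; rewrite neq_ij rij cij !eqxx.
have -> : row_col_coef s = (-1) ^+ (q : bool).
  rewrite /row_col_coef (bigD1 p) //= (bigD1 q) ?Qq ?def_s ?eqxx //=.
  rewrite big1 ?addr0 => [|q' /andP[/andP[Qq' /eqP e] neq_q]]; last first.
    by case: (row_col_decomp_uniq Pp Qq' Pp Qq e) neq_q => _ ->; rewrite eqxx.
  rewrite big1 ?addr0 // => p' /andP[Pp' neq_p].
  apply: big1 => q' /andP[Qq' /eqP e].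
  by case: (row_col_decomp_uniq Pp' Qq' Pp Qq e) neq_p => ->; rewrite eqxx.
rewrite def_s rGM mulmxA row_sum_mull // -mulmxA col_sum_mulr //.
by rewrite -scalemxAr.
Qed.

Lemma class_sum_central (D : {set {perm T}}) g :
    (forall s t, (s ^ t \in D)%g = (s \in D)) ->
  (\sum_(s in D) rG s) *m rG g = rG g *m \sum_(s in D) rG s.
Proof.
move=> DJ; rewrite mulmx_suml mulmx_sumr (reindex_inj (@conjg_inj _ g^-1)%g) /=.
apply: eq_big => [s | s _]; first by rewrite DJ.
by rewrite -!rGM conjgE invgK mulgA mulgKV.
Qed.

(** The class sum is central, so it can be moved between the row sum and the column sum, where von
    Neumann's lemma applies to each of its terms. *)
Lemma symmetrizer_class_sum (D : {set {perm T}}) :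
    (forall s t, (s ^ t \in D)%g = (s \in D)) ->
  row_sum *m col_sum *m (\sum_(s in D) rG s)
    = (\sum_(p in P) \sum_(q in Q | (p * q)%g \in D) (-1) ^+ (q : bool))
        *: (row_sum *m col_sum).
Proof.
move=> DJ; have -> : row_sum *m col_sum *m (\sum_(s in D) rG s)
    = row_sum *m (\sum_(s in D) rG s) *m col_sum.
  rewrite -!mulmxA; congr (_ *m _); rewrite {1}/col_sum mulmx_suml mulmx_sumr.
  apply: eq_bigr => q _.
  by rewrite -scalemxAl -scalemxAr class_sum_central.
have -> : row_sum *m (\sum_(s in D) rG s) *m col_sum
    = \sum_(s in D) row_col_coef s *: (row_sum *m col_sum).
  under [RHS]eq_bigr do rewrite -row_sum_mul_col_sum.
  by rewrite -mulmx_suml -mulmx_sumr.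
rewrite -scaler_suml; congr (_ *: _); rewrite exchange_big; apply: eq_bigr => p _ /=.
under eq_bigr do rewrite big_mkcondr; rewrite exchange_big [RHS]big_mkcondr.
apply: eq_bigr => q _; rewrite -big_mkcondr /=.
have [Dpq | nDpq] := ifPn; last first.
  by apply: big1 => s /andP[Ds /eqP e]; rewrite e Ds in nDpq.
rewrite (bigD1 (p * q)%g) ?Dpq ?eqxx //= big1 ?addr0 // => s.
by case/andP=> /andP[_ /eqP->]; rewrite eqxx.
Qed.

End RowColumn.

(** * Inclusion-exclusion over the fixed cells *)

Section InclusionExclusion.

Variables (T : finType) (R : numDomainType).

(** If A has at most one point per column, only the identity is left; otherwise multiplication by a
    transposition of two column mates in A reverses all signs. *)
Lemma sum_sign_fiber_stab_on (c : T -> nat) (A : {set T}) :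
  \sum_(q in fiber_stab_on c A) (-1) ^+ (q : bool)
    = (dinjectiveb c A)%:R :> R.
Proof.
have [inj_c | ] := boolP (dinjectiveb c A).
  rewrite (bigD1 1%g) ?group1 //= odd_perm1 big1 ?addr0 // => q /andP[].
  rewrite in_fiber_stab_on => /andP[/fiber_stabP cq Aq] /eqP[]; apply/permP=> i.
  rewrite perm1; have [Ai | nAi] := boolP (i \in A); last exact: out_perm Aq nAi.
  by move/dinjectiveP: inj_c; apply; rewrite ?perm_closed // cq.
case/dinjectivePn=> i Ai [j /andP[neq_ji Aj] cij].
have tA : tperm i j \in fiber_stab_on c A.
  by rewrite in_fiber_stab_on tperm_fiber_stab ?perm_on_tperm.
set S := \sum_(q in _) _; have SN : S = - S.
  rewrite {1}/S (reindex_inj (mulgI (tperm i j))) /= -sumrN.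
  apply: eq_big => [q | q _]; first by rewrite groupMl.
  by rewrite odd_permM odd_tperm eq_sym neq_ji signr_addb mulN1r.
apply/eqP; move/eqP: SN; rewrite -subr_eq0 opprK -mulr2n mulrn_eq0 /=.
by move=> ->.
Qed.

(** One term in the expansion of the product of the factors 1 - [i is fixed]: A collects the factors
    from which 1 is taken. *)
Lemma prod_indicator (A : {set T}) (b : pred T) :
  \prod_i (if i \in A then 1 else - (b i)%:R)
    = (-1) ^+ (#|T| - #|A|) * [forall (i | i \notin A), b i]%:R :> R.
Proof.
have -> : \prod_i (if i \in A then 1 else - (b i)%:R)
    = \prod_(i in ~: A) - (b i)%:R :> R.
  rewrite [RHS]big_mkcond; apply: eq_bigr => i _; rewrite inE.
  by case: (i \in A).
rewrite prodrN cardsCs setCK; congr (_ * _).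
have [/forall_inP allb | ] := boolP [forall (i | i \notin A), b i].
  by apply: big1 => i; rewrite inE => /allb->.
rewrite negb_forall => /existsP[i]; rewrite negb_imply => /andP[nAi nbi].
by rewrite (bigD1 i) ?inE //= (negbTE nbi) mul0r.
Qed.

Variables (r c : T -> nat) (N : nat).
Hypothesis rc_inj : forall i j, r i = r j -> c i = c j -> i = j.
Hypothesis ltrN : forall i, (r i < N)%N.

(** A is the complement of the prescribed fixed cells. Both p and q are then supported on A, so the
    sum for A is the number of such p times the signed sum over such q. *)
Lemma sum_sign_row_col_derangements :
  \sum_(p in fiber_stab r)
      \sum_(q in fiber_stab c | [forall i, (p * q)%g i != i]) (-1) ^+ (q : bool)
    = \sum_(A : {set T} | dinjectiveb c A) (-1) ^+ (#|T| - #|A|) *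
        (\prod_(y < N) #|[set i in A | r i == y]|`!)%:R :> R.
Proof.
have derE p q : p \in fiber_stab r -> q \in fiber_stab c ->
    [forall i, (p * q)%g i != i]%:R
      = \sum_(A : {set T}) (-1) ^+ (#|T| - #|A|) *
          (perm_on A p && perm_on A q)%:R :> R.
  move=> Pp Qq.
  have -> : [forall i, (p * q)%g i != i]%:R
      = \prod_i (1 + - ((p * q)%g i == i)%:R) :> R.
    have [/forallP der | ] := boolP [forall i, (p * q)%g i != i].
      by rewrite big1 // => i _; rewrite (negbTE (der i)) oppr0 addr0.
    rewrite negb_forall => /existsP[i /negPn/eqP fix_i].
    by rewrite (bigD1 i) //= fix_i eqxx subrr mul0r.
  rewrite bigA_distr /=; apply: eq_bigr => A _.
  rewrite (prod_indicator A (fun i => (p * q)%g i == i)); congr (_ * (_ : bool)%:R).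
  apply/forall_inP/andP=> [fixA | [Ap Aq] i nAi].
    by split; apply/subsetP=> i; rewrite inE; apply: contraNT => /fixA;
      rewrite permM (row_col_fixed rc_inj) // => /andP[].
  by rewrite permM (out_perm Ap nAi) (out_perm Aq nAi).
transitivity (\sum_(A : {set T}) (-1) ^+ (#|T| - #|A|) *
    \sum_(p in fiber_stab_on r A) \sum_(q in fiber_stab_on c A)
      (-1) ^+ (q : bool) : R); last first.
  rewrite [RHS]big_mkcond; apply: eq_bigr => A _.
  rewrite sum_sign_fiber_stab_on sumr_const (card_fiber_stab_on A ltrN).
  by case: ifP => _; rewrite ?mul0rn ?mulr0.
transitivity (\sum_(p in fiber_stab r) \sum_(q in fiber_stab c)
    \sum_(A : {set T}) (-1) ^+ (#|T| - #|A|) *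
      ((perm_on A p && perm_on A q)%:R * (-1) ^+ (q : bool)) : R).
  apply: eq_bigr => p Pp; rewrite big_mkcondr; apply: eq_bigr => q Qq.
  under eq_bigr do rewrite mulrA; rewrite -mulr_suml -derE //.
  by case: ifP; rewrite ?mul1r ?mul0r.
under eq_bigr do rewrite exchange_big; rewrite exchange_big.
apply: eq_bigr => A _ /=.
under eq_bigr do rewrite -mulr_sumr; rewrite -mulr_sumr; congr (_ * _).
rewrite [RHS](eq_bigl (fun p => (p \in fiber_stab r) && perm_on A p)); last first.
  by move=> p; rewrite in_fiber_stab_on.
rewrite [RHS]big_mkcondr; apply: eq_bigr => p _ /=.
case: (perm_on A p) => /=; last by apply: big1 => q _; rewrite mul0r.
rewrite [RHS](eq_bigl (fun q => (q \in fiber_stab c) && perm_on A q)); last first.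
  by move=> q; rewrite in_fiber_stab_on.
rewrite [RHS]big_mkcondr; apply: eq_bigr => q _ /=.
by case: (perm_on A q); rewrite ?mul1r ?mul0r.
Qed.

End InclusionExclusion.

(** * The scalar by which the derangements act on the Specht module *)

Section Eta.

Variables (n : nat) (la : seq nat).
Hypothesis sum_la : sumn la = n.

Let r (i : 'I_n) := reshape_index la i.
Let c (i : 'I_n) := reshape_offset la i.

Lemma diagram_inj (i j : 'I_n) : r i = r j -> c i = c j -> i = j.
Proof.
move=> rij cij; apply: val_inj; rewrite /= -(reshape_indexK la i).
by rewrite -(reshape_indexK la j) -/(r i) -/(r j) rij -/(c i) -/(c j) cij.
Qed.

Lemma diagram_left (i j : 'I_n) :
  (c j <= c i)%N -> exists2 i', r i' = r i & c i' = c j.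
Proof.
move=> le_ji; have lt_j : (c j < nth 0%N la (r i))%N.
  by apply: leq_ltn_trans le_ji _; apply: reshape_offsetP; rewrite sum_la.
have lt_n : (flatten_index la (r i) (c j) < n)%N.
  by rewrite -[X in (_ < X)%N]sum_la flatten_indexP.
by exists (Ordinal lt_n); [apply: flatten_indexKl | apply: flatten_indexKr].
Qed.

Lemma diagram_row_lt (i : 'I_n) : (r i < size la)%N.
Proof. by apply: reshape_indexP; rewrite sum_la. Qed.

Local Notation rG := (Sn_regular n).
Local Notation y := (young_symmetrizer n la).

Lemma young_symmetrizerE : y = gring_row (row_sum r rG *m col_sum c rG).
Proof.
congr gring_row; rewrite mulmx_suml; apply: eq_bigr => p _.
rewrite mulmx_sumr; apply: eq_bigr => q _.
by rewrite -scalemxAr repr_mxM ?inE.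
Qed.

(** Its coordinate at the identity is 1, since p q = 1 forces p = q = 1. *)
Lemma young_symmetrizer_neq0 : y != 0.
Proof.
have G1 : 1%g \in [set: 'S_n]%G by rewrite inE.
apply/eqP=> /matrixP/(_ 0 (gring_index [set: 'S_n]%G 1%g))/eqP/negP[].
rewrite !mxE summxE (bigD1 1%g) ?(group1 (fiber_stab_group r)) //= summxE.
rewrite (bigD1 1%g) ?(group1 (fiber_stab_group c)) //= odd_perm1 scale1r !mxE.
rewrite gring_indexK ?inE // !mulg1 !eqxx.
rewrite big1 ?addr0 => [|q /andP[_ neq_q]]; last first.
  rewrite !mxE gring_indexK ?inE // !mul1g eqxx /=.
  rewrite (can_in_eq (gring_indexK (G := [set: 'S_n]%G))) ?inE //.
  by rewrite eq_sym (negbTE neq_q) mulr0.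
rewrite big1 ?addr0 ?oner_eq0 // => p /andP[Pp neq_p].
rewrite summxE big1 // => q Qq.
rewrite !mxE gring_indexK ?inE // !mul1g eqxx /=.
rewrite (can_in_eq (gring_indexK (G := [set: 'S_n]%G))) ?inE //.
have [pq1 | _] := eqVneq 1%g (p * q)%g; last by rewrite mulr0.
have := row_col_decomp_uniq diagram_inj (group1 (fiber_stab_group r))
  (group1 (fiber_stab_group c)) Pp Qq.
by rewrite mulg1 => /(_ pq1)[p1 _]; rewrite -p1 eqxx in neq_p.
Qed.

(** The sum of the derangements multiplies the Young symmetrizer by z and is central, so it acts as
    z on the whole right ideal. The trace divided by the degree is then z. *)
Lemma eta_row_col :
  eta n la = \sum_(p in fiber_stab r)
    \sum_(q in fiber_stab c | (p * q)%g \in derangements n) (-1) ^+ (q : bool).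
Proof.
set z := RHS.
have derJ (s t : 'S_n) : (s ^ t \in derangements n)%g = (s \in derangements n).
  rewrite !inE; apply/forallP/forallP=> der i.
    by have := der (t i); rewrite permJ (inj_eq perm_inj).
  by rewrite -[i](permKV t) permJ (inj_eq perm_inj).
have yZ : y *m (\sum_(s in derangements n) rG s) = z *: y.
  rewrite young_symmetrizerE -gring_row_mul -linearZ.
  congr gring_row.
  by rewrite (symmetrizer_class_sum diagram_inj diagram_left) // pnatr_eq0.
set U := cyclic_mx rG y.
have UZ m (W : 'M_(m, _)) :
    (W <= U)%MS -> W *m (\sum_(s in derangements n) rG s) = z *: W.
  move=> sWU; apply/row_matrixP=> i; rewrite row_mul linearZ /=.
  have /cyclic_mxP[A E_A ->] : (row i W <= U)%MS := submx_trans (row_sub i W) sWU.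
  rewrite -mulmxA; have -> : A *m (\sum_(s in derangements n) rG s)
      = (\sum_(s in derangements n) rG s) *m A.
    have /envelop_mxP[a ->] := E_A; rewrite mulmx_suml mulmx_sumr.
    by apply: eq_bigr => s _; rewrite -scalemxAl -scalemxAr class_sum_central.
  by rewrite mulmxA yZ scalemxAl.
(* The degree by which [eta] divides is nonzero. *)
have Ud : (\rank U)%:R != 0 :> algC.
  by rewrite pnatr_eq0 mxrank_eq0 cyclic_mx_eq0 young_symmetrizer_neq0.
have sumZ : \sum_(s in derangements n) specht_repr n la s = z%:M.
  apply: (@val_submod_inj _ _ U); rewrite linear_sum /= -scalemx1 linearZ /=.
  rewrite -(UZ _ (val_submod 1%:M)) ?val_submodP // mulmx_sumr.
  by apply: eq_bigr => s _; rewrite -[X in val_submod X]mul1mx val_submodJ ?inE.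
rewrite /eta /chi cfRepr1; under eq_bigr do rewrite cfunE inE mulr1n.
by rewrite -linear_sum /= sumZ mxtrace_scalar -[z *+ _]mulr_natl mulKf.
Qed.

Lemma eta_transversal_sum :
  eta n la = \sum_(A : {set 'I_n} | dinjectiveb c A) (-1) ^+ (n - #|A|) *
    (\prod_(y < size la) #|[set i in A | r i == y]|`!)%:R.
Proof.
have := sum_sign_row_col_derangements algC diagram_inj diagram_row_lt.
rewrite card_ord eta_row_col => <-.
by apply: eq_bigr => p _; apply: eq_bigl => q; rewrite [_ \in derangements n]inE.
Qed.

End Eta.

(** * Derangement numbers *)

Section Subfactorial.

Variable R : numDomainType.

(** The number of derangements of m points; the falling factorial is the binomial coefficient of m
    and j times j!. *)
Definition subfact (m : nat) : R :=
  \sum_(j < m.+1) (-1) ^+ (m - j) * (m ^_ j)%:R.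

Lemma subfactS m : subfact m.+1 = m.+1%:R * subfact m + (-1) ^+ m.+1.
Proof.
rewrite /subfact big_ord_recl /= subn0 mulr1 addrC mulr_sumr; congr (_ + _).
apply: eq_bigr => j _; rewrite subSS ffactSS natrM mulrCA.
by rewrite /bump /=.
Qed.

(** Having no alternating term, this recurrence gives positivity by induction. *)
Lemma subfactSS m : subfact m.+2 = m.+1%:R * (subfact m.+1 + subfact m).
Proof.
rewrite subfactS -[m.+2%:R]natr1 mulrDl mul1r {2}subfactS mulrDr -!addrA.
by congr (_ + _); rewrite (exprS _ m.+1) mulN1r subrr addr0.
Qed.

Lemma subfact_ge0 m : 0 <= subfact m.
Proof.
suff [] : 0 <= subfact m /\ 0 <= subfact m.+1 by [].
elim: m => [|m [IH0 IH1]]; last by rewrite subfactSS mulr_ge0 ?addr_ge0 ?ler0n.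
rewrite subfactS /subfact big_ord_recl big_ord0 subnn expr0 !mul1r expr1.
by rewrite addr0 subrr.
Qed.

Lemma subfact_gt0 m : (2 <= m)%N -> 0 < subfact m.
Proof.
case: m => [|[|m]] // _; elim: m => [|m IHm].
  rewrite subfactSS subfactS /subfact big_ord_recl big_ord0 subnn expr0.
  by rewrite !mul1r expr1 addr0 subrr add0r ltr01.
by rewrite subfactSS mulr_gt0 ?ltr0n // ltr_wpDr ?subfact_ge0.
Qed.

(** Grouping by size turns the sum into the defining one. X will be the set of first-row cells still
    available. *)
Lemma sum_subset_sign_fact (T : finType) (X : {set T}) :
  \sum_(B : {set T} | B \subset X) (-1) ^+ (#|X| - #|B|) * (#|B|`!)%:R
    = subfact #|X|.
Proof.
pose card_in (B : {set T}) : 'I_#|X|.+1 := inord #|B|.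
rewrite (partition_big card_in xpredT) //=; apply: eq_bigr => j _.
have le_jX : (j <= #|X|)%N by rewrite -ltnS.
rewrite -(bin_ffact #|X| j) natrM -(cards_draws X j) mulrCA mulr_natl -sumr_const.
have drawsP (B : {set T}) : (B \subset X) && (card_in B == j)
    = (B \in [set A : {set T} | A \subset X & #|A| == j]).
  rewrite inE; have [sBX | //] := boolP (B \subset X).
  by rewrite -val_eqE /= inordK // ltnS subset_leq_card.
rewrite (eq_bigl _ _ drawsP); apply: eq_bigr => B.
by rewrite inE => /andP[_ /eqP->].
Qed.

End Subfactorial.

(** * Subsets of a disjoint union of two index ranges *)

Section SplitSet.

Variables (m k : nat).

Definition join_set (BC : {set 'I_m} * {set 'I_k}) : {set 'I_(m + k)} :=
  (lshift k @: BC.1) :|: (@rshift m k @: BC.2).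

Lemma lshift_join_set B C i : (lshift k i \in join_set (B, C)) = (i \in B).
Proof.
rewrite inE mem_imset; last exact: lshift_inj.
by case: imsetP => [[j _ /eqP] | _]; rewrite ?eq_lrshift // orbF.
Qed.

Lemma rshift_join_set B C i : (rshift m i \in join_set (B, C)) = (i \in C).
Proof.
rewrite inE orbC mem_imset; last exact: rshift_inj.
by case: imsetP => [[j _ /eqP] | _]; rewrite ?eq_rlshift // orbF.
Qed.

Lemma join_set_bij : bijective join_set.
Proof.
pose parts (A : {set 'I_(m + k)}) : {set 'I_m} * {set 'I_k} :=
  ([set i | lshift k i \in A], [set i | rshift m i \in A]).
exists parts.
  by case=> B C; congr pair; apply/setP=> i;
    rewrite inE ?lshift_join_set ?rshift_join_set.
move=> A; apply/setP=> i; case: (split_ordP i) => j ->.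
  by rewrite lshift_join_set inE.
by rewrite rshift_join_set inE.
Qed.

Lemma card_join_set (p : pred 'I_(m + k)) B C :
  #|[set i in join_set (B, C) | p i]|
    = (#|[set i in B | p (lshift k i)]| + #|[set i in C | p (rshift m i)]|)%N.
Proof.
rewrite -!sum1_card [LHS]big_mkcond big_split_ord /=.
congr (_ + _)%N; rewrite [RHS]big_mkcond; apply: eq_bigr => i _.
  by rewrite in_set [in RHS]in_set lshift_join_set.
by rewrite in_set [in RHS]in_set rshift_join_set.
Qed.

End SplitSet.

(** * Splitting off the first row of the diagram *)

Section FirstRow.

Variables (R : numDomainType) (m k : nat) (nu : seq nat).
Hypothesis sum_nu : sumn nu = k.
Hypothesis le_km : (k <= m)%N.

Lemma reshape_index_lshift (i : 'I_m) : reshape_index (m :: nu) (lshift k i) = 0%N.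
Proof. by rewrite /reshape_index /= subn_eq0 ltn_ord. Qed.

Lemma reshape_offset_lshift (i : 'I_m) : reshape_offset (m :: nu) (lshift k i) = i.
Proof. by rewrite /reshape_offset reshape_index_lshift subn0. Qed.

Lemma reshape_index_rshift (i : 'I_k) :
  reshape_index (m :: nu) (rshift m i) = (reshape_index nu i).+1.
Proof. by rewrite /reshape_index /= subn_eq0 ltnNge leq_addr /= -addnS addKn. Qed.

Lemma reshape_offset_rshift (i : 'I_k) :
  reshape_offset (m :: nu) (rshift m i) = reshape_offset nu i.
Proof. by rewrite /reshape_offset reshape_index_rshift /= subnDl. Qed.

Lemma reshape_offset_lt (i : 'I_k) : (reshape_offset nu i < m)%N.
Proof.
have lt_i : (i < sumn nu)%N by rewrite sum_nu.
have le_sumn s j : (nth 0%N s j <= sumn s)%N.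
  elim: s j => [|a s IHs] [|j] //=; first exact: leq_addr.
  by apply: leq_trans (IHs j) _; exact: leq_addl.
apply: leq_trans (reshape_offsetP lt_i) _; apply: leq_trans (le_sumn _ _) _.
by rewrite sum_nu.
Qed.

Let col (i : 'I_k) := Ordinal (reshape_offset_lt i).

(** Cells of the first row never share a column, so conflicts occur only within C or between a cell
    of B and a cell of C below it. *)
Lemma dinjectiveb_join_set (B : {set 'I_m}) (C : {set 'I_k}) :
  dinjectiveb (fun i : 'I_(m + k) => reshape_offset (m :: nu) i) (join_set (B, C))
    = dinjectiveb (fun i : 'I_k => reshape_offset nu i) C
      && (B \subset ~: (col @: C)).
Proof.
apply/dinjectiveP/andP=> [inj_c | [/dinjectiveP inj_c /subsetP sB] i j].
  split.
    apply/dinjectiveP=> i j Ci Cj /= cij; apply: (@rshift_inj m).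
    by apply: inj_c; rewrite ?rshift_join_set //= !reshape_offset_rshift.
  apply/subsetP=> i Bi; rewrite inE; apply/imsetP=> -[j Cj def_i].
  have /eqP : lshift k i = rshift m j.
    apply: inj_c; rewrite ?lshift_join_set ?rshift_join_set //=.
    by rewrite reshape_offset_lshift reshape_offset_rshift def_i.
  by rewrite eq_lrshift.
case: (split_ordP i) => i' ->; case: (split_ordP j) => j' ->;
  rewrite ?lshift_join_set ?rshift_join_set
          ?reshape_offset_lshift ?reshape_offset_rshift => Xi Xj cij.
- by congr lshift; apply: val_inj.
- have := sB _ Xi; rewrite inE => /imsetP[]; exists j' => //.
  exact: val_inj.
- have := sB _ Xj; rewrite inE => /imsetP[]; exists i' => //.
  exact: val_inj.
by congr rshift; apply: inj_c.
Qed.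

(** For fixed C, the set B runs over the subsets of the m - |C| free columns, and the signed sum of
    |B|! is a derangement number. The sign [(-1) ^+ k] remains. *)
Lemma transversal_sum_first_row :
  \sum_(A : {set 'I_(m + k)} |
          dinjectiveb (fun i : 'I_(m + k) => reshape_offset (m :: nu) i) A)
     (-1) ^+ (m + k - #|A|) *
       (\prod_(y < (size nu).+1)
          #|[set i in A | reshape_index (m :: nu) i == y]|`!)%:R
  = (-1) ^+ k *
    \sum_(C : {set 'I_k} | dinjectiveb (fun i : 'I_k => reshape_offset nu i) C)
       (\prod_(y < size nu) #|[set i in C | reshape_index nu i == y]|`!)%:R
         * subfact R (m - #|C|).
Proof.
rewrite (reindex _ (onW_bij _ (join_set_bij m k))) /=.
rewrite (eq_bigl (fun BC : {set 'I_m} * {set 'I_k} =>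
   dinjectiveb (fun i : 'I_k => reshape_offset nu i) BC.2 &&
   (BC.1 \subset ~: (col @: BC.2))));
  last by case=> B C; exact: dinjectiveb_join_set.
rewrite mulr_sumr.
transitivity (\sum_(C : {set 'I_k} |
    dinjectiveb (fun i : 'I_k => reshape_offset nu i) C)
  \sum_(B : {set 'I_m} | B \subset ~: (col @: C))
     (-1) ^+ (m + k - #|join_set (B, C)|) *
       (\prod_(y < (size nu).+1)
          #|[set i in join_set (B, C) | reshape_index (m :: nu) i == y]|`!)%:R : R).
  rewrite (exchange_big_dep xpredT) //= pair_big_dep /=.
  by apply: eq_big => [[B C]|[B C] _] //.
apply: eq_bigr => C /dinjectiveP inj_c.
have cardC : #|~: (col @: C)| = (m - #|C|)%N.
  rewrite cardsCs setCK card_ord card_in_imset // => i j Ci Cj /(congr1 val).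
  exact: inj_c.
rewrite -cardC -sum_subset_sign_fact !mulr_sumr; apply: eq_bigr => B sB.
have -> : #|join_set (B, C)| = (#|B| + #|C|)%N.
  have setIdT (T : finType) (X : {set T}) : [set i in X | xpredT i] = X.
    by apply/setP=> i; rewrite inE andbT.
  by have := card_join_set xpredT B C; rewrite !setIdT.
have le_B : (#|B| <= m - #|C|)%N by rewrite -cardC subset_leq_card.
have le_C : (#|C| <= m)%N.
  by apply: leq_trans le_km; rewrite -[X in (_ <= X)%N]card_ord max_card.
have -> : (m + k - (#|B| + #|C|) = k + (m - #|C| - #|B|))%N by lia.
have -> : (\prod_(y < (size nu).+1)
      #|[set i in join_set (B, C) | reshape_index (m :: nu) i == y]|`!
    = #|B|`! * \prod_(y < size nu) #|[set i in C | reshape_index nu i == y]|`!)%N.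
  rewrite big_ord_recl; congr (_`! * _)%N.
    rewrite card_join_set [X in (_ + X)%N]eq_card0 ?addn0.
      by apply: eq_card => i; rewrite inE reshape_index_lshift andbT.
    by move=> i; rewrite !inE reshape_index_rshift andbF.
  apply: eq_bigr => y _; congr (_`!); rewrite card_join_set eq_card0.
    by apply: eq_card => i; rewrite !inE reshape_index_rshift.
  by move=> i; rewrite !inE reshape_index_lshift andbF.
rewrite exprD natrM cardC -!mulrA; congr (_ * _).
by rewrite [RHS]mulrC mulrA.
Qed.

End FirstRow.

(** * Computable form of the transversal sums *)

Fixpoint sublists (X : Type) (s : seq X) : seq (seq X) :=
  if s is x :: s' then [seq x :: l | l <- sublists s'] ++ sublists s'
  else [:: [::]].

Lemma map_sublists (X Y : Type) (f : X -> Y) (s : seq X) :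
  [seq map f l | l <- sublists s] = sublists (map f s).
Proof. by elim: s => //= x s IHs; rewrite map_cat -IHs -!map_comp. Qed.

Lemma mem_sublists (X : eqType) (s l : seq X) : (l \in sublists s) = subseq l s.
Proof.
elim: s l => [|x s IHs] l; first by rewrite inE subseq0.
rewrite mem_cat IHs; case: l => [|y l] /=; first by rewrite sub0seq orbT.
have [-> | neq_yx] := eqVneq y x.
  rewrite mem_map ?IHs => [|l1 l2 []] //.
  by have [// | nls] := boolP (subseq l s); apply: contraNF nls;
    apply: subseq_trans (subseq_cons _ _).
by case: mapP => [[l' _ [eq_yx _]] | //]; rewrite eq_yx eqxx in neq_yx.
Qed.

Lemma sublists_uniq (X : eqType) (s : seq X) : uniq s -> uniq (sublists s).
Proof.
elim: s => //= x s IHs /andP[nsx us]; rewrite cat_uniq (IHs us) andbT.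
rewrite map_inj_uniq => [|l1 l2 []] //; rewrite (IHs us) /=.
apply/hasPn=> l; rewrite mem_sublists => /mem_subseq sls.
by apply: contra nsx => /mapP[l' _ def_l]; rewrite sls // def_l mem_head.
Qed.

(** The enumerations of the subsets are exactly the subsequences of [enum T]. *)
Lemma big_set_sublists (R : nmodType) (T : finType) (G : seq T -> R) :
  \sum_(C : {set T}) G (enum C) = \sum_(l <- sublists (enum T)) G l.
Proof.
rewrite -(big_map (fun C : {set T} => enum C) xpredT G); apply: perm_big.
apply: uniq_perm => [||l].
- rewrite map_inj_uniq ?index_enum_uniq // => C D eqCD; apply/setP=> i.
  by rewrite -mem_enum eqCD mem_enum.
- by rewrite sublists_uniq ?enum_uniq.
rewrite mem_sublists; apply/mapP/idP=> [[C _ ->] | sl].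
  by rewrite {1}/enum_mem -enumT filter_subseq.
exists [set x in l]; first exact: mem_index_enum.
rewrite [LHS](subseq_uniqP (enum_uniq T) sl) enumT [RHS]/enum_mem.
by apply: eq_filter => i; rewrite /= inE.
Qed.

(* The coefficient of the j-th term of |eta (m :: nu)| in lemma
   [eta_first_row], in a form that the kernel can evaluate. *)
Definition transversal_weight (nu : seq nat) (j : nat) : nat :=
  sumn [seq foldr muln 1%N
              [seq (count (fun i => reshape_index nu i == y) l)`!
                 | y <- iota 0 (size nu)]
          | l <- sublists (iota 0 (sumn nu))
              & uniq (map (reshape_offset nu) l) && (size l == j)].

(** Both sides equal a sum over the sublists of [iota 0 k]: grouping it by length gives the weights,
    and reading the sublists as enumerations gives the sets C. *)
Lemma sum_transversal_weight (R : numDomainType) (k : nat) (nu : seq nat)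
    (g : nat -> R) : sumn nu = k ->
  \sum_(C : {set 'I_k} | dinjectiveb (fun i : 'I_k => reshape_offset nu i) C)
      (\prod_(y < size nu) #|[set i in C | reshape_index nu i == y]|`!)%:R * g #|C|
    = \sum_(j < k.+1) (transversal_weight nu j)%:R * g j.
Proof.
move=> sum_nu.
pose W (l : seq nat) : nat :=
  foldr muln 1%N [seq (count (fun i => reshape_index nu i == y) l)`!
                    | y <- iota 0 (size nu)].
pose ok (l : seq nat) := uniq (map (reshape_offset nu) l).
transitivity (\sum_(l <- sublists (iota 0 k) | ok l) (W l)%:R * g (size l));
  last first.
  pose sz (l : seq nat) : 'I_k.+1 := inord (size l).
  rewrite (partition_big sz xpredT) //=; apply: eq_bigr => j _.
  rewrite /transversal_weight sum_nu sumnE big_map big_filter natr_sum mulr_suml.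
  rewrite big_seq_cond [RHS]big_seq_cond.
  have szE l : l \in sublists (iota 0 k) -> (sz l == j) = (size l == j).
    rewrite mem_sublists => /size_subseq; rewrite size_iota => le_l.
    by rewrite -val_eqE /= inordK.
  apply: eq_big => [l | l].
    by have [/szE-> | ] := boolP (l \in _).
  by move=> /andP[/szE-> /andP[_ /eqP->]].
pose G (l : seq 'I_k) : R :=
  if ok (map val l) then (W (map val l))%:R * g (size (map val l)) else 0.
rewrite -val_enum_ord -map_sublists big_map [RHS]big_mkcond.
rewrite -[RHS](big_set_sublists G) big_mkcond {}/G.
apply: eq_bigr => C _; rewrite /ok -map_comp.
rewrite -[uniq _]/(dinjectiveb (fun i : 'I_k => reshape_offset nu i) C).
case: ifP => // _.
rewrite size_map -cardE; congr (_%:R * _).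
have iotaE : iota 0 (size nu) = index_iota 0 (size nu) by rewrite /index_iota subn0.
rewrite /W iotaE foldrE big_map big_mkord.
apply: eq_bigr => y _; rewrite count_map -size_filter; congr (_`!).
rewrite cardE; congr size; rewrite /enum_mem -filter_predI.
by apply: eq_filter => i; rewrite /= inE andbC.
Qed.

Lemma eta_first_row (m k : nat) (nu : seq nat) :
    sumn nu = k -> (k <= m)%N ->
  eta (m + k) (m :: nu)
    = (-1) ^+ k *
      \sum_(j < k.+1) (transversal_weight nu j)%:R * subfact algC (m - j).
Proof.
move=> sum_nu le_km; rewrite eta_transversal_sum /= ?sum_nu //.
rewrite transversal_sum_first_row //.
by rewrite (sum_transversal_weight (fun j => subfact algC (m - j)) sum_nu).
Qed.

(** * Enumeration of small partitions and the finite check *)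

Fixpoint compositions (fuel k : nat) : seq (seq nat) :=
  if k is 0 then [:: [::]] else
  if fuel is fuel'.+1 then
    flatten [seq [seq a :: s | s <- compositions fuel' (k - a)] | a <- iota 1 k]
  else [::].

(** Each part is at least 1 and costs one unit of fuel, so k units suffice. *)
Lemma mem_compositions (fuel k : nat) (nu : seq nat) :
  0%N \notin nu -> sumn nu = k -> (k <= fuel)%N -> nu \in compositions fuel k.
Proof.
elim: nu fuel k => [|a nu IHnu] fuel k /=; first by move=> _ <-; case: fuel.
rewrite inE negb_or => /andP[a_gt0 nu0]; rewrite eq_sym -lt0n in a_gt0.
move=> def_k; case: k fuel def_k => [|k] [|fuel] def_k lekf //; try lia.
apply/flatten_mapP; exists a; first by rewrite mem_iota; lia.
by apply: map_f; apply: IHnu => //; lia.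
Qed.

Definition lex_ltb (b : nat) (mu la : seq nat) : bool :=
  has (fun i => all (fun j => nth 0%N mu j == nth 0%N la j) (iota 0 i)
                  && (nth 0%N mu i < nth 0%N la i)%N) (iota 0 b).

Definition partitions (k : nat) : seq (seq nat) :=
  [seq nu <- compositions k k | sorted geq nu].

(** The conjunct [2 <= k] puts the index 2 in range; for k = 1 there is a single partition and
    nothing to compare. *)
Definition weights_decrease (k : nat) : bool :=
  all (fun la => all (fun mu => lex_ltb k.+1 mu la ==>
    [&& (2 <= k)%N,
        all (fun j => transversal_weight mu j <= transversal_weight la j)%N
          (iota 0 k.+1)
      & (transversal_weight mu 2 < transversal_weight la 2)%N])
    (partitions k)) (partitions k).

Lemma weights_decrease_le4 k : (1 <= k <= 4)%N -> weights_decrease k.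
Proof. by case: k => [|[|[|[|[|k]]]]] // _; vm_compute. Qed.

(** At the first difference the entry of [la] is positive, so a search up to the length of [la]
    finds it. *)
Lemma lex_ltW (b : nat) (mu la : seq nat) :
  (size la <= b)%N -> lex_lt mu la -> lex_ltb b mu la.
Proof.
move=> le_b [i [eq_i lt_i]]; apply/hasP; exists i; last first.
  by rewrite lt_i andbT; apply/allP=> j; rewrite mem_iota => /eq_i->.
rewrite mem_iota /=; apply: leq_trans le_b; rewrite ltnNge.
by apply: contraTN lt_i => le_i; rewrite [nth _ la i]nth_default.
Qed.

Lemma size_le_sumn (s : seq nat) : 0%N \notin s -> (size s <= sumn s)%N.
Proof.
elim: s => //= a s IHs; rewrite inE negb_or => /andP[a_gt0 /IHs]; lia.
Qed.

Lemma partition_behead (n m : nat) (la : seq nat) :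
    (0 < m)%N -> is_partition n la -> nth 0%N la 0 = m ->
  exists2 nu, la = m :: nu &
    [/\ sumn nu = (n - m)%N, (size nu <= n - m)%N & nu \in partitions (n - m)].
Proof.
case: la => [|a nu] m_gt0 /and3P[/= sorted_la nz /eqP sum_la] def_a.
  by rewrite -def_a in m_gt0.
have nz_nu : 0%N \notin nu by move: nz; rewrite inE negb_or => /andP[].
have sum_nu : sumn nu = (n - m)%N by lia.
exists nu; first by rewrite def_a.
split=> //; first by rewrite -sum_nu size_le_sumn.
by rewrite mem_filter (path_sorted sorted_la) mem_compositions.
Qed.

(** * Term-by-term comparison of the absolute values *)

Theorem theorem1p4 (k n : nat) (hk : (1 <= k <= 4)%N) (hn : (2 * k <= n)%N)
    (la mu : seq nat)
    (hla : is_partition n la) (hmu : is_partition n mu)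
    (hla1 : nth 0%N la 0 = (n - k)%N) (hmu1 : nth 0%N mu 0 = (n - k)%N)
    (hlt : lex_lt mu la) :
  `|eta n mu| <= `|eta n la| /\ ((7 <= n)%N -> `|eta n mu| < `|eta n la|).
Proof.
have m_gt0 : (0 < n - k)%N by lia.
have [la' def_la [sum_la size_la la_part]] := partition_behead m_gt0 hla hla1.
have [mu' def_mu [sum_mu size_mu mu_part]] := partition_behead m_gt0 hmu hmu1.
have kE : (n - (n - k))%N = k by lia.
rewrite kE in sum_la size_la la_part sum_mu size_mu mu_part.
have lt_mu_la : lex_ltb k.+1 mu' la'.
  (* The first parts agree, so the first difference lies in the remaining rows, with its index
     lowered by one. *)
  apply: (@lex_ltW _ _ _ (leqW size_la)); case: hlt => [[|i]] [eq_i lt_i].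
    by rewrite def_la def_mu ltnn in lt_i.
  exists i; split; last by rewrite def_la def_mu in lt_i.
  by move=> j ltji; have := eq_i j.+1 ltji; rewrite def_la def_mu.
have /allP/(_ _ la_part) := weights_decrease_le4 hk.
move/allP/(_ _ mu_part)/implyP/(_ lt_mu_la) => /and3P[k_ge2 /allP le_w lt_w].
have le_km : (k <= n - k)%N by lia.
have nE : n = (n - k + k)%N by lia.
(* All terms are nonnegative, so the absolute value only removes the sign. *)
have normE nu : sumn nu = k -> `|eta n ((n - k)%N :: nu)|
    = \sum_(j < k.+1) (transversal_weight nu j)%:R * subfact algC (n - k - j).
  move=> sum_nu; rewrite {1}nE eta_first_row // normrM normrX normrN1 expr1n mul1r.
  by rewrite ger0_norm // sumr_ge0 // => j _; rewrite mulr_ge0 ?ler0n ?subfact_ge0.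
rewrite def_la def_mu !normE //.
have le_term (j : 'I_k.+1) :
    (transversal_weight mu' j)%:R * subfact algC (n - k - j)
      <= (transversal_weight la' j)%:R * subfact algC (n - k - j).
  by rewrite ler_wpM2r ?subfact_ge0 // ler_nat le_w // mem_iota /= add0n ltn_ord.
split=> [|n_ge7]; first exact: ler_sum.
(* The term j = 2 is strict: [n >= 7] with [n >= 2 * k] and [k <= 4] gives [n - k - 2 >= 2], so its
   derangement number is positive. *)
pose j2 := Ordinal (k_ge2 : (2 < k.+1)%N).
rewrite (bigD1 j2) //= [ltRHS](bigD1 j2) //= ltr_leD ?ler_sum //.
by rewrite ltr_pM2r ?ltr_nat // subfact_gt0 //; lia.
Qed.
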